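(* Let $A\in\{0,1\}^{n\times n}$ be a symmetric binary matrix, and consider the two rank-one problems $$(\mathrm{P}_0)\quad \min_{h\in\mathbb{R}^n_+}\ \|A-hh^T\|_{\mathrm{OD},0},\qquad\qquad (\mathrm{P}_1)\quad \min_{h\in[0,1]^n}\ \|A-hh^T\|_{\mathrm{OD},1}.$$ Any optimal solution of $(\mathrm{P}_0)$ can be transformed into a binary optimal solution which is also optimal for $(\mathrm{P}_1)$, and vice versa (that is, any optimal solution of $(\mathrm{P}_1)$ can be transformed into a binary optimal solution which is also optimal for $(\mathrm{P}_0)$).
   Context: For a matrix $M\in\mathbb{R}^{n\times n}$, only off-diagonal entries are taken into account: $\|M\|_{\mathrm{OD},0}$ is the number of pairs $(i,j)$ with $1\le i,j\le n$, $i\ne j$ and $M_{ij}\neq 0$, and $\|M\|_{\mathrm{OD},1}=\sum_{i=1}^n\sum_{j\ne i}|M_{ij}|$. $\mathbb{R}^n_+$ denotes the set of vectors of $\mathbb{R}^n$ with nonnegative entries. A solution $h$ is called binary if $h\in\{0,1\}^n$. *)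

(* Defs.v *)
From mathcomp Require Import all_boot all_order all_algebra.
From mathcomp Require Import reals.

Set Implicit Arguments.
Unset Strict Implicit.
Unset Printing Implicit Defensive.

Import Order.TTheory GRing.Theory Num.Theory.
Local Open Scope ring_scope.

Definition od_norm0 (R : realType) (n : nat) (M : 'M[R]_n) : nat :=
  #|[set p : 'I_n * 'I_n | (p.1 != p.2) && (M p.1 p.2 != 0)]|.

Definition od_norm1 (R : realType) (n : nat) (M : 'M[R]_n) : R :=
  \sum_i \sum_(j | j != i) `|M i j|.

Definition is_minimizer (T : Type) (disp : Order.disp_t) (U : porderType disp)
    (D : T -> Prop) (f : T -> U) (x : T) : Prop :=
  D x /\ forall y, D y -> (f x <= f y)%O.

Definition binary_mx (R : realType) (m n : nat) (M : 'M[R]_(m, n)) : Prop :=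
  forall i j, M i j = 0 \/ M i j = 1.

Definition nonneg_vec (R : realType) (n : nat) (h : 'cV[R]_n) : Prop :=
  forall i, 0 <= h i 0.

Definition unit_box (R : realType) (n : nat) (h : 'cV[R]_n) : Prop :=
  forall i, 0 <= h i 0 <= 1.

Definition optimal_P0 (R : realType) (n : nat) (A : 'M[R]_n) (h : 'cV[R]_n) : Prop :=
  is_minimizer (@nonneg_vec R n) (fun x => od_norm0 (A - x *m x^T)) h.

Definition optimal_P1 (R : realType) (n : nat) (A : 'M[R]_n) (h : 'cV[R]_n) : Prop :=
  is_minimizer (@unit_box R n) (fun x => od_norm1 (A - x *m x^T)) h.

(* What "h can be transformed into the binary vector b" means: b is obtained
   from h by replacing entries of h that are not already 0 or 1.  Requiring only
   that some binary b exists would leave b unrelated to h. *)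
Definition rounds_to (R : realType) (n : nat) (h b : 'cV[R]_n) : Prop :=
  binary_mx b /\ forall i, h i 0 = 0 \/ h i 0 = 1 -> b i 0 = h i 0.

(* Main.v *)
Require Import Defs.
From mathcomp Require Import all_boot all_order all_algebra.
From mathcomp Require Import reals ring lra.

(** Both problems have the same binary candidates, on which their objectives
    agree, because every entry of [A - b *m b^T] is then [0], [1] or [-1]
    ([od_norm1_binary]).  So it is enough to round every feasible vector of
    either problem to a binary one without increasing the objective.

    - For the counting objective, replace every positive entry by 1
      ([round_P0]).  An off-diagonal entry of [A] that was reproduced exactly is
      still reproduced: a zero of [A] needs a zero factor, which stays zero, and
      a one of [A] needs two positive factors, which both become one.

    - For the l1 objective on the box, every off-diagonal error is [h i * h j] or
      [1 - h i * h j] with [i != j].  The objective is therefore affine in each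
      coordinate separately, and moving one coordinate to the better endpoint of
      [0, 1] does not increase it ([od_norm1_interpolate]).  Doing this for the
      fractional coordinates one at a time ends at a binary vector ([round_P1]).

    A binary vector is thus optimal for either problem exactly when it is the
    best binary vector, and this condition is the same for the two problems
    ([binary_optimal_iff]). *)

Set Implicit Arguments.
Unset Strict Implicit.
Unset Printing Implicit Defensive.

Import Order.TTheory GRing.Theory Num.Theory.
Local Open Scope ring_scope.

Lemma outer_entryE (R : realType) (n : nat) (A : 'M[R]_n) (h : 'cV[R]_n) i j :
  (A - h *m h^T) i j = A i j - h i 0 * h j 0.
Proof. by rewrite !mxE big_ord1 !mxE. Qed.

Lemma binary_nonneg (R : realType) (n : nat) (b : 'cV[R]_n) :
  binary_mx b -> nonneg_vec b.
Proof. by move=> bB i; case: (bB i 0) => ->. Qed.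

Lemma binary_unit_box (R : realType) (n : nat) (b : 'cV[R]_n) :
  binary_mx b -> unit_box b.
Proof. by move=> bB i; case: (bB i 0) => ->; rewrite ?lexx ?ler01. Qed.

Lemma od_norm1_binary (R : realType) (n : nat) (A : 'M[R]_n) (b : 'cV[R]_n) :
  binary_mx A -> binary_mx b ->
  od_norm1 (A - b *m b^T) = (od_norm0 (A - b *m b^T))%:R.
Proof.
move=> AB bB; rewrite /od_norm1 /od_norm0 pair_big_dep /= -sum1_card natr_sum.
rewrite [RHS](eq_bigl (fun p : 'I_n * 'I_n =>
  (p.1 != p.2) && ((A - b *m b^T) p.1 p.2 != 0))); last first.
  by move=> p; rewrite inE.
rewrite [RHS]big_mkcondr; apply: eq_big => [p|p _]; first by rewrite eq_sym.
rewrite outer_entryE.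
have [->|nz] /= := eqVneq (A p.1 p.2 - b p.1 0 * b p.2 0) 0.
  by rewrite normr0.
move: nz; case: (AB p.1 p.2) => ->; case: (bB p.1 0) => ->;
  case: (bB p.2 0) => ->;
  by rewrite !(mul0r, mulr0, mul1r, subr0, sub0r, subrr, oppr0,
    normrN, normr1, eqxx).
Qed.

Lemma round_P0 (R : realType) (n : nat) (A : 'M[R]_n) (h : 'cV[R]_n) :
  binary_mx A -> nonneg_vec h ->
  exists2 b, rounds_to h b &
    (od_norm0 (A - b *m b^T) <= od_norm0 (A - h *m h^T))%N.
Proof.
move=> AB h0; exists (\col_i (h i 0 != 0)%:R).
  split=> [i j|i]; rewrite mxE; first by case: eqP; [left|right].
  by case=> ->; rewrite ?eqxx ?oner_eq0.
apply/subset_leq_card/subsetP => -[i j]; rewrite !inE /= => /andP[-> /=].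
apply: contra_neq; rewrite !outer_entryE !mxE.
have [->|hi] := eqVneq (h i 0) 0; first by rewrite /= !mul0r.
have [->|hj] := eqVneq (h j 0) 0; first by rewrite /= !mulr0.
case: (AB i j) => ->; rewrite /= ?mulr1 ?subrr //.
by move/eqP; rewrite sub0r oppr_eq0 mulf_eq0 (negPf hi) (negPf hj).
Qed.

Definition set_coord (R : realType) (n : nat) (h : 'cV[R]_n) (k : 'I_n) (t : R) :
    'cV[R]_n :=
  \col_i (if i == k then t else h i 0).

Lemma set_coord_unit_box (R : realType) (n : nat) (h : 'cV[R]_n) k t :
  unit_box h -> 0 <= t <= 1 -> unit_box (set_coord h k t).
Proof. by move=> hB tB i; rewrite mxE; case: ifP. Qed.

(** On the box the absolute values have constant sign, so each error is affine
    in [h i * h j]; as [i != j], at most one of the two factors is the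
    coordinate [k], and no square of it occurs. *)
Lemma od_norm1_interpolate (R : realType) (n : nat) (A : 'M[R]_n)
    (h : 'cV[R]_n) (k : 'I_n) :
  binary_mx A -> unit_box h ->
  let F x := od_norm1 (A - x *m x^T) in
  F h = (1 - h k 0) * F (set_coord h k 0) + h k 0 * F (set_coord h k 1).
Proof.
move=> AB hB F; rewrite /F /od_norm1 !mulr_sumr -big_split /=.
apply: eq_bigr => i _; rewrite !mulr_sumr -big_split /=.
apply: eq_bigr => j ji; rewrite !outer_entryE.
have errE x : unit_box x ->
    `|A i j - x i 0 * x j 0| = A i j + (1 - 2 * A i j) * (x i 0 * x j 0).
  move=> xB; have /andP[xi0 xi1] := xB i; have /andP[xj0 xj1] := xB j.
  have p0 := mulr_ge0 xi0 xj0; have p1 := mulr_ile1 xi0 xj0 xi1 xj1.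
  case: (AB i j) => ->; last by rewrite ger0_norm ?subr_ge0 //; ring.
  by rewrite sub0r normrN ger0_norm //; ring.
have b0 : unit_box (set_coord h k 0).
  by apply: set_coord_unit_box; rewrite ?lexx ?ler01.
have b1 : unit_box (set_coord h k 1).
  by apply: set_coord_unit_box; rewrite ?lexx ?ler01.
rewrite !errE // !mxE.
have [ik|_] := eqVneq i k; have [jk|_] := eqVneq j k; last by ring.
- by rewrite ik jk eqxx in ji.
- by rewrite ik; ring.
- by rewrite jk; ring.
Qed.

Lemma round_P1 (R : realType) (n : nat) (A : 'M[R]_n) (h : 'cV[R]_n) :
  binary_mx A -> unit_box h ->
  exists2 b, rounds_to h b &
    od_norm1 (A - b *m b^T) <= od_norm1 (A - h *m h^T).
Proof.
move=> AB.
pose frac (x : 'cV[R]_n) := [set i | (x i 0 != 0) && (x i 0 != 1)].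
have [m] := ubnP #|frac h|; elim: m h => // m IHm h lt_m hB.
have [h_bin|[k kfrac]] := set_0Vmem (frac h).
  exists h => //; split=> // i j; rewrite ord1.
  have := in_set0 i; rewrite -h_bin inE => /negbT.
  by rewrite negb_and !negbK => /orP[] /eqP; [left|right].
have [t tB le_t] : exists2 t : R, t = 0 \/ t = 1 &
    od_norm1 (A - set_coord h k t *m (set_coord h k t)^T)
      <= od_norm1 (A - h *m h^T).
  have /= -> := od_norm1_interpolate k AB hB.
  have /andP[hk0 hk1] := hB k.
  have [le01|/ltW le10] := leP (od_norm1 (A - set_coord h k 0 *m (set_coord h k 0)^T))
    (od_norm1 (A - set_coord h k 1 *m (set_coord h k 1)^T)).
    by exists 0; [left | nra].
  by exists 1; [right | nra].
have ltc : (#|frac (set_coord h k t)| < m)%N.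
  rewrite -ltnS (leq_trans _ lt_m) // ltnS; apply: proper_card.
  apply/properP; split; last first.
    exists k => //; rewrite inE mxE eqxx.
    by case: tB => ->; rewrite eqxx ?andbF.
  apply/subsetP => i; rewrite !inE mxE; case: (i =P k) => // _.
  by case: tB => ->; rewrite eqxx ?andbF.
have [|b [bB b_keep] le_b] := IHm (set_coord h k t) ltc.
  by apply: set_coord_unit_box => //; case: tB => ->; rewrite ?lexx ?ler01.
exists b; last exact: le_trans le_b le_t.
split=> // i hi.
have ik : i != k.
  apply: contraTneq kfrac => <-; rewrite inE.
  by case: hi => ->; rewrite eqxx ?andbF.
by have := b_keep i; rewrite mxE (negPf ik); exact.
Qed.

Lemma optimal_P0_binaryP (R : realType) (n : nat) (A : 'M[R]_n) (b : 'cV[R]_n) :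
  binary_mx A -> binary_mx b ->
  optimal_P0 A b <->
  forall c : 'cV[R]_n, binary_mx c ->
    (od_norm0 (A - b *m b^T) <= od_norm0 (A - c *m c^T))%N.
Proof.
move=> AB bB; split=> [[_ b_min] c cB|b_min].
  exact: b_min (binary_nonneg cB).
split=> [|y y0]; first exact: binary_nonneg.
have [c [cB _] le_c] := round_P0 AB y0.
exact: leq_trans (b_min c cB) le_c.
Qed.

Lemma optimal_P1_binaryP (R : realType) (n : nat) (A : 'M[R]_n) (b : 'cV[R]_n) :
  binary_mx A -> binary_mx b ->
  optimal_P1 A b <->
  forall c : 'cV[R]_n, binary_mx c ->
    od_norm1 (A - b *m b^T) <= od_norm1 (A - c *m c^T).
Proof.
move=> AB bB; split=> [[_ b_min] c cB|b_min].
  exact: b_min (binary_unit_box cB).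
split=> [|y yB]; first exact: binary_unit_box.
have [c [cB _] le_c] := round_P1 AB yB.
exact: le_trans (b_min c cB) le_c.
Qed.

Lemma binary_optimal_iff (R : realType) (n : nat) (A : 'M[R]_n) (b : 'cV[R]_n) :
  binary_mx A -> binary_mx b -> optimal_P0 A b <-> optimal_P1 A b.
Proof.
move=> AB bB.
split=> [/(optimal_P0_binaryP AB bB) | /(optimal_P1_binaryP AB bB)] b_min.
  apply/(optimal_P1_binaryP AB bB) => c cB.
  by rewrite !od_norm1_binary // ler_nat b_min.
apply/(optimal_P0_binaryP AB bB) => c cB.
by rewrite -(ler_nat R) -!od_norm1_binary // b_min.
Qed.

Theorem theorem1 (R : realType) (n : nat) (A : 'M[R]_n)
    (A_binary : binary_mx A) (A_sym : A^T = A) :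
  (forall h : 'cV[R]_n, optimal_P0 A h ->
     exists b : 'cV[R]_n, rounds_to h b /\ optimal_P0 A b /\ optimal_P1 A b) /\
  (forall h : 'cV[R]_n, optimal_P1 A h ->
     exists b : 'cV[R]_n, rounds_to h b /\ optimal_P1 A b /\ optimal_P0 A b).
Proof.
split=> h [hD h_min].
  have [b hb le_b] := round_P0 A_binary hD; have [bB _] := hb.
  have opt_b : optimal_P0 A b.
    split=> [|y yD]; first exact: binary_nonneg.
    exact: leq_trans le_b (h_min y yD).
  by exists b; split=> //; split=> //; apply/binary_optimal_iff.
have [b hb le_b] := round_P1 A_binary hD; have [bB _] := hb.
have opt_b : optimal_P1 A b.
  split=> [|y yD]; first exact: binary_unit_box.
  exact: le_trans le_b (h_min y yD).
by exists b; split=> //; split=> //; apply/binary_optimal_iff.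
Qed.
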